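(* Let $p$ be an odd prime, $q=p^2$, and let $f\in\mathcal{RF}$ (functions $\mathbb{F}_{p^2}\to\mathbb{F}_p$) with $\varepsilon\in\{\pm1\}$ the sign of its Walsh transform, such that $\varepsilon\eta_0(-1)=-1$. Let $\mathcal{C}_f=\{(af(x)+\mathrm{Tr}_{q/p}(bx)+c)_{x\in\mathbb{F}_q}:a\in\mathbb{F}_p,b\in\mathbb{F}_q,c\in\mathbb{F}_p\}$. Then $\mathcal{C}_f$ is a $(p^2,4,p^2-p-1,p;3)$-LRC and $\mathcal{C}_f^{\perp}$ is a $(p^2,p^2-4,4,p;p^2-p-2)$-LRC. Moreover, $\mathcal{C}_f$ is $k$-optimal, and $\mathcal{C}_f^{\perp}$ is both $k$-optimal and $d$-optimal.
   Context: $\zeta_p=e^{2\pi i/p}$; $\eta_0$ is the quadratic character of $\mathbb{F}_p$; $p^*=(-1)^{(p-1)/2}p$ with $\sqrt{p^*}=\sqrt p$ if $p\equiv1\pmod4$ and $\sqrt{-1}\sqrt p$ otherwise. Weakly regular bent $f:\mathbb{F}_{p^e}\to\mathbb{F}_p$ with sign $\varepsilon$ and dual $f^*$: $\sum_x\zeta_p^{f(x)-\mathrm{Tr}_{p^e/p}(\beta x)}=\varepsilon\sqrt{p^*}^e\zeta_p^{f^*(\beta)}$ for all $\beta$. $\mathcal{RF}$: weakly regular bent $f$ with $f(0)=0$ and $f(ax)=a^hf(x)$ for all $a\in\mathbb{F}_p^*$, $x$, some positive even $h$ with $\gcd(h-1,p-1)=1$. An $(n,k,d,q;r)$-LRC is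 an $[n,k,d]$ linear code over $\mathbb{F}_q$ whose locality is $r$, the locality being the smallest $r$ such that every coordinate $i$ has a set $R_i$ of $r$ other coordinates with $c_i$ a function of $\mathbf{c}_{R_i}$ for all codewords $\mathbf{c}$. $d$-optimal: $d=n-k-\lceil k/r\rceil+2$ (Singleton-like bound met). $k$-optimal: $k=\min_{t\in\mathbb{Z}^+}[rt+k^{(q)}_{opt}(n-t(r+1),d)]$ (Cadambe–Mazumdar bound met), where $k^{(q)}_{opt}(n,d)$ is the largest dimension of a $q$-ary linear code of length $n$ and minimum distance $d$. *)

(* Defs.v *)
From HB Require Import structures.
From mathcomp Require Import all_boot all_order all_algebra all_field.
Set Implicit Arguments. Unset Strict Implicit. Unset Printing Implicit Defensive.
Import Order.TTheory GRing.Theory Num.Theory.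
Local Open Scope ring_scope.

Definition Fp_to (p : nat) (L : fieldType) (a : 'F_p) : L := (nat_of_ord a)%:R.

(* Absolute trace Tr_{p^e/p}(x) = \sum_{i<e} x^(p^i), read back in 'F_p
   (it lies in the prime subfield when #|L| = p^e). *)
Definition trace_Fp (p e : nat) (L : finFieldType) (x : L) : 'F_p :=
  odflt 0 [pick k : 'F_p | Fp_to L k == \sum_(i < e) x ^+ (p ^ i)].

(* zeta_p = e^{2 pi i / p} in algC: p.-root(-1) = e^{i pi / p}. *)
Definition zeta (p : nat) : algC := (p.-root (-1)) ^+ 2.

Definition eta0 (p : nat) (a : 'F_p) : algC :=
  if a == 0 then 0 else if [exists y : 'F_p, y ^+ 2 == a] then 1 else -1.

Definition pstar (p : nat) : algC := (-1) ^+ ((p - 1) %/ 2) * p%:R.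

(* Weakly regular bent with sign eps and dual fstar. sqrt(p^* ) = sqrtC (p^* ),
   which is sqrt p if p^* > 0 and sqrt(-1) sqrt p otherwise. *)
Definition weakly_regular_bent (p e : nat) (L : finFieldType) (f : L -> 'F_p)
    (eps : algC) (fstar : L -> 'F_p) : Prop :=
  (eps = 1 \/ eps = -1) /\
  forall beta : L,
    \sum_(x : L) zeta p ^+ (nat_of_ord (f x - trace_Fp p e (beta * x)))
    = eps * (sqrtC (pstar p)) ^+ e * zeta p ^+ (nat_of_ord (fstar beta)).

Definition in_RF (p e : nat) (L : finFieldType) (f : L -> 'F_p) : Prop :=
  (exists eps fstar, weakly_regular_bent e f eps fstar) /\
  f 0 = 0 /\
  exists h : nat, [/\ (0 < h)%N, ~~ odd h, gcdn h.-1 p.-1 = 1%N &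
    forall (a : 'F_p) (x : L), a != 0 -> f (Fp_to L a * x) = a ^+ h * f x].

Definition is_lincode (p : nat) (I : finType) (C : {set {ffun I -> 'F_p}}) : bool :=
  [&& (0 : {ffun I -> 'F_p}) \in C,
      [forall u in C, forall v in C, (u + v) \in C] &
      [forall a : 'F_p, forall u in C, [ffun i => a * u i] \in C]].

Definition code_dim (p : nat) (I : finType) (C : {set {ffun I -> 'F_p}}) : nat :=
  logn p #|C|.

Definition wt (p : nat) (I : finType) (c : {ffun I -> 'F_p}) : nat :=
  #|[set i | c i != 0]|.

Definition has_mindist (p : nat) (I : finType) (C : {set {ffun I -> 'F_p}}) (d : nat) : bool :=
  [exists c in C, (c != 0) && (wt c == d)] &&
  [forall c in C, (c != 0) ==> (d <= wt c)%N].

Definition dual_code (p : nat) (I : finType) (C : {set {ffun I -> 'F_p}}) :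
  {set {ffun I -> 'F_p}} :=
  [set v : {ffun I -> 'F_p} | [forall c in C, \sum_(i : I) v i * c i == 0]].

Definition recovers (p : nat) (I : finType) (C : {set {ffun I -> 'F_p}}) (i : I) (R : {set I}) : bool :=
  [forall u in C, forall v in C, [forall j in R, u j == v j] ==> (u i == v i)].

Definition has_locality (p : nat) (I : finType) (C : {set {ffun I -> 'F_p}}) (r : nat) : bool :=
  [forall i : I, exists R : {set I}, [&& i \notin R, #|R| == r & recovers C i R]].

Definition locality_is (p : nat) (I : finType) (C : {set {ffun I -> 'F_p}}) (r : nat) : Prop :=
  has_locality C r /\ forall r' : nat, (r' < r)%N -> ~~ has_locality C r'.

Definition is_LRC (p : nat) (I : finType) (C : {set {ffun I -> 'F_p}}) (n k d r : nat) : Prop :=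
  [/\ is_lincode C, #|I| = n, code_dim C = k, has_mindist C d & locality_is C r].

(* Singleton-like bound met: d = n - k - ceil(k/r) + 2 *)
Definition d_optimal (n k d r : nat) : Prop :=
  (d + k + (k + r.-1) %/ r = n + 2)%N.

(* k_opt^{(p)}(m, d): largest dimension of a p-ary linear code of length m with
   minimum distance d (0 if there is none). *)
Definition kopt (p m d : nat) : nat :=
  \max_(C : {set {ffun 'I_m -> 'F_p}} | is_lincode C && has_mindist C d) code_dim C.

(* Cadambe--Mazumdar bound met: k = min_{t >= 1} [r t + k_opt(n - t(r+1), d)],
   t ranging over positive integers with t(r+1) <= n. *)
Definition k_optimal (p n k d r : nat) : Prop :=
  (exists t : nat, [/\ (0 < t)%N, (t * r.+1 <= n)%N & k = (r * t + kopt p (n - t * r.+1) d)%N]) /\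
  (forall t : nat, (0 < t)%N -> (t * r.+1 <= n)%N -> (k <= r * t + kopt p (n - t * r.+1) d)%N).

Definition code_f (p e : nat) (L : finFieldType) (f : L -> 'F_p) : {set {ffun L -> 'F_p}} :=
  [set w : {ffun L -> 'F_p} | [exists a : 'F_p, exists b : L, exists c : 'F_p,
              w == [ffun x => a * f x + trace_Fp p e (b * x) + c]]].

(* Main.v *)
Require Import Defs.
From HB Require Import structures.
From mathcomp Require Import all_boot all_order all_algebra all_field.
From mathcomp Require Import zify ring.
Import Order.TTheory GRing.Theory Num.Theory.
Set Implicit Arguments. Unset Strict Implicit. Unset Printing Implicit Defensive.
Local Open Scope ring_scope.

(** Since [e = 2], the Walsh values of [f] are [eps p* zeta^(f* b) = -p zeta^(f* b)],
    with a rational factor. As [1 + X + ... + X^(p-1)] is, up to scaling, the only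
    rational relation of degree less than [p] satisfied by [zeta], the fibres of
    [f - Tr(b x)] have size [1] or [p + 1]. So the words [a f + Tr(b x) + c] have [1] or
    [p + 1] zeros if [a <> 0], and [p] zeros if [a = 0 <> b]: the code has dimension [4]
    and distance [p^2 - p - 1]. Geometrically the graph of [f] is a set of [p^2] points
    in AG(3,p) meeting every plane in at most [p + 1] points; counting along the pencil
    of planes through two of them shows that no three are collinear, so the dual
    distance is at least [4], and four points in a common plane give words of weight
    [4]. The locality of a linear code is read off the supports of its dual words.
    [k]-optimality needs [kopt (p^2 - 4) (p^2 - p - 1) = 1], by the Plotkin average,
    and [kopt (p + 1) 4 = p - 2], by the Singleton bound and the dual of the code
    punctured to the zeros of a minimum weight word. *)

(** * The primitive root [zeta p] and the additive character [chi] of the prime field *)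

Section AdditiveCharacter.

Variable p : nat.
Hypothesis p_pr : prime p.

(** Since [zeta p ^+ p = 1], the order is 1 or p. Order 1 would make the principal root
    [p.-root (-1)] equal to 1 or -1: its p-th power is -1, which excludes 1, and a principal root of
    degree at least 2 is never negative. *)
Lemma zeta_prim : p.-primitive_root (zeta p).
Proof.
have p_gt1 := prime_gt1 p_pr; have p_gt0 := prime_gt0 p_pr.
have zp : p.-root (-1 : algC) ^+ p = -1 by rewrite rootCK.
have z2p : zeta p ^+ p = 1 by rewrite /zeta exprAC zp sqrrN expr1n.
have [m prim_m m_dvd] := prim_order_exists p_gt0 z2p.
have [_ /(_ m m_dvd)/orP[]/eqP Em] := primeP p_pr; last by rewrite -{1}Em.
move: (prim_expr_order prim_m); rewrite Em expr1 /zeta => /eqP.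
rewrite sqrf_eq1 => /orP[]/eqP z1.
  move: zp; rewrite z1 expr1n => /eqP; rewrite -subr_eq0 opprK.
  by rewrite -(natrD _ 1 1) pnatr_eq0.
by have := rootC_lt0 (-1 : algC) p_gt1; rewrite z1 oppr_lt0 ltr01.
Qed.

Definition chi (a : 'F_p) : algC := zeta p ^+ (nat_of_ord a).

Lemma chi_eq (a : 'F_p) n : n = nat_of_ord a %[mod p] -> zeta p ^+ n = chi a.
Proof. by move=> E; apply/eqP; rewrite (eq_prim_root_expr zeta_prim) E. Qed.

Lemma chiD a b : chi (a + b) = chi a * chi b.
Proof.
rewrite /chi -exprD; apply/esym/chi_eq.
by rewrite /= modn_dvdm // Fp_cast.
Qed.

Lemma chi_eq1 a : (chi a == 1) = (a == 0).
Proof.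
rewrite /chi -(prim_order_dvd zeta_prim) -val_eqE /=.
have ltap : (nat_of_ord a < p)%N by rewrite -[X in (_ < X)%N](Fp_cast p_pr).
by case: (posnP a) => [->|a_gt0]; rewrite ?dvdn0 // gtnNdvd //; lia.
Qed.

End AdditiveCharacter.

(** * Linear codes over the prime field: duality, locality, puncturing and bounds *)

Section LinearCodes.

Variable p : nat.
Hypothesis p_pr : prime p.

Section Basics.
Variable I : finType.
Implicit Types (C D : {set {ffun I -> 'F_p}}) (u v w c : {ffun I -> 'F_p}).

Definition dotp u v : 'F_p := \sum_i u i * v i.

Lemma word_neq0 c : c != 0 -> exists i, c i != 0.
Proof.
move=> c0; apply/existsP; apply: contraNT c0; rewrite negb_exists => /forallP h.
by apply/eqP/ffunP=> i; rewrite ffunE; apply/eqP/negPn/h.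
Qed.

Lemma lincodeP C :
  reflect [/\ 0 \in C, {in C &, forall u v, u + v \in C}
    & forall a, {in C, forall u, [ffun i => a * u i] \in C}] (is_lincode C).
Proof.
apply: (iffP and3P) => -[C0 CD CZ]; split=> //.
- by move=> u v uC vC; move/forall_inP: CD => /(_ u uC)/forall_inP/(_ v vC).
- by move=> a u uC; move/forallP: CZ => /(_ a)/forall_inP/(_ u uC).
- by apply/forall_inP=> u uC; apply/forall_inP=> v vC; apply: CD.
- by apply/forallP=> a; apply/forall_inP=> u uC; apply: CZ.
Qed.

Lemma lincode0 C : is_lincode C -> 0 \in C. Proof. by case/lincodeP. Qed.

Lemma lincodeD C u v : is_lincode C -> u \in C -> v \in C -> u + v \in C.
Proof. by case/lincodeP=> _ CD _; apply: CD. Qed.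

Lemma lincodeZ C a u : is_lincode C -> u \in C -> [ffun i => a * u i] \in C.
Proof. by case/lincodeP=> _ _; apply. Qed.

Lemma lincodeB C u v : is_lincode C -> u \in C -> v \in C -> u - v \in C.
Proof.
move=> linC uC vC; have -> : u - v = u + [ffun i => -1 * v i].
  by apply/ffunP=> i; rewrite !ffunE mulN1r.
by rewrite lincodeD ?lincodeZ.
Qed.

Lemma dotpC u v : dotp u v = dotp v u.
Proof. by apply: eq_bigr => i _; rewrite mulrC. Qed.

Lemma dotpDl u v w : dotp (u + v) w = dotp u w + dotp v w.
Proof. by rewrite -big_split; apply: eq_bigr => i _; rewrite ffunE mulrDl. Qed.

Lemma dotpZl a u w : dotp [ffun i => a * u i] w = a * dotp u w.
Proof. by rewrite mulr_sumr; apply: eq_bigr => i _; rewrite ffunE mulrA. Qed.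

Lemma dual_codeP C v : reflect {in C, forall c, dotp v c = 0} (v \in dual_code C).
Proof. by rewrite inE; apply: (iffP forall_inP) => h c /h/eqP. Qed.

Lemma dual_lincode C : is_lincode (dual_code C).
Proof.
apply/lincodeP; split=> [|u v /dual_codeP uC /dual_codeP vC|a u /dual_codeP uC];
  apply/dual_codeP=> c cC.
- by apply: big1 => i _; rewrite ffunE mul0r.
- by rewrite dotpDl uC ?vC ?addr0.
- by rewrite dotpZl uC ?mulr0.
Qed.

Definition delta (i : I) : {ffun I -> 'F_p} := [ffun j => (j == i)%:R].

Lemma dotp_delta i c : dotp (delta i) c = c i.
Proof.
rewrite /dotp (bigD1 i) //= ffunE eqxx mul1r big1 ?addr0 // => j jNi.
by rewrite ffunE (negPf jNi) mul0r.
Qed.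

(** Orthogonality of characters: if [c0] in [C] is not orthogonal to [v], translating the summation
    by [c0] multiplies the sum by [chi (dotp v c0)], which is not 1. *)
Lemma sum_chi_dotp C v : is_lincode C ->
  \sum_(c in C) chi (dotp v c) = if v \in dual_code C then #|C|%:R else 0.
Proof.
move=> linC; case: ifPn => [/dual_codeP vC|].
  by rewrite (eq_bigr (fun=> 1)) => [|c /vC->//]; rewrite sumr_const.
rewrite inE negb_forall_in => /exists_inP[c0 c0C nz].
set S := \sum_(c in C) _.
have : S = chi (dotp v c0) * S.
  rewrite {1}/S (reindex_inj (addrI c0)) mulr_sumr; apply: eq_big => [c|c _].
    apply/idP/idP => [h|cC]; last exact: lincodeD.
    by rewrite -(addKr c0 c) addrC lincodeB.
  by rewrite -chiD // [dotp v _]dotpC dotpDl !(dotpC _ v).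
move/eqP; rewrite -subr_eq0 -{1}[S]mul1r -mulrBl mulf_eq0 subr_eq0 eq_sym.
by rewrite chi_eq1 // (negPf nz) => /eqP.
Qed.

Lemma card_words : #|{ffun I -> 'F_p}| = (p ^ #|I|)%N.
Proof. by rewrite card_ffun card_Fp. Qed.

(* Sum chi <v, c> over all v and all c in C in both orders. *)
Lemma card_dual C : is_lincode C -> (#|C| * #|dual_code C| = p ^ #|I|)%N.
Proof.
move=> linC; apply/eqP; rewrite -(eqr_nat algC); apply/eqP.
transitivity (\sum_v \sum_(c in C) chi (dotp v c)).
  rewrite (eq_bigr _ (fun v _ => sum_chi_dotp v linC)) -big_mkcond /=.
  by rewrite sumr_const natrM mulr_natr.
rewrite exchange_big (bigD1 (0 : {ffun I -> 'F_p})) ?lincode0 //= [X in _ + X]big1 ?addr0.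
  rewrite (eq_bigr (fun=> 1)) => [|v _].
    by rewrite sumr_const -card_words.
  by rewrite /dotp big1 // => i _; rewrite ffunE mulr0.
move=> c /andP[_ cn0].
have linT : is_lincode [set: {ffun I -> 'F_p}] 
  by apply/lincodeP; split=> [|u v _ _|a u _]; rewrite inE.
transitivity (\sum_(v in [set: {ffun I -> 'F_p}]) chi (dotp c v)).
  by apply: eq_big => [v|v _]; rewrite ?inE // dotpC.
rewrite sum_chi_dotp //; case: ifPn => // /dual_codeP h.
case/eqP: cn0; apply/ffunP=> i; rewrite ffunE -(dotp_delta i).
by rewrite dotpC h // inE.
Qed.

Lemma dualK C : is_lincode C -> dual_code (dual_code C) = C.
Proof.
move=> linC; apply/esym/eqP; rewrite eqEcard; apply/andP; split.
  by apply/subsetP=> c cC; apply/dual_codeP=> v /dual_codeP h; rewrite dotpC h.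
have h1 := card_dual linC; have h2 := card_dual (dual_lincode C).
have: (0 < #|dual_code C|)%N by apply/card_gt0P; exists 0; apply/lincode0/dual_lincode.
by move=> h; rewrite -(leq_pmul2l h) h2 mulnC h1.
Qed.

Lemma card_lincode C : is_lincode C -> #|C| = (p ^ code_dim C)%N.
Proof.
move=> linC; have : (#|C| %| p ^ #|I|)%N by rewrite -(card_dual linC) dvdn_mulr.
by case/(dvdn_pfactor _ _ p_pr) => m _ Em; rewrite /code_dim Em pfactorK.
Qed.

Lemma code_dim_dual C : is_lincode C -> (code_dim C + code_dim (dual_code C) = #|I|)%N.
Proof.
move=> linC; apply/eqP; rewrite -(eqn_exp2l _ _ (prime_gt1 p_pr)) expnD.
by rewrite -!card_lincode ?dual_lincode // card_dual.
Qed.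

(** The hypothesis makes [h] identify words as a homomorphism would, so its fibres on [C] are cosets
    of one kernel. Serves both for reading one coordinate and for puncturing. *)
Lemma card_fibers (W : finType) C (h : {ffun I -> 'F_p} -> W) :
    is_lincode C -> {in C &, forall u v, (h u == h v) = (h (u - v) == h 0)} ->
  #|C| = (#|h @: C| * #|[set c in C | h c == h 0%R]|)%N.
Proof.
move=> linC hB; rewrite -sum1_card (partition_big_imset h) /= -sum_nat_const.
apply: eq_bigr => _ /imsetP[u uC ->]; rewrite -sum1_card.
rewrite (reindex_inj (addIr u)) /=; apply: eq_bigl => c; rewrite inE.
apply/andP/andP=> -[cC hc].
  have c'C : c \in C by rewrite -(addrK u c) lincodeB.
  by split=> //; move: hc; rewrite hB // addrK.
have cuC : c + u \in C by apply: lincodeD.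
by split=> //; rewrite hB // addrK.
Qed.

Lemma recovers_dual C i (R : {set I}) : is_lincode C -> i \notin R -> recovers C i R ->
  exists2 w, w \in dual_code C & w i != 0 /\ forall j, w j != 0 -> j \in i |: R.
Proof.
move=> linC iR /forall_inP rec.
(* With E the words supported on R, the words of C vanishing on R are the dual of
   A = C^perp + E, so by biduality [delta i] lies in A. *)
pose E := [set e : {ffun I -> 'F_p} | [forall j, (e j != 0) ==> (j \in R)]].
pose A := [set u : {ffun I -> 'F_p} | [exists w in dual_code C, u - w \in E]].
have EP (e : {ffun I -> 'F_p}) : reflect (forall j, e j != 0 -> j \in R) (e \in E).
  by rewrite inE; apply: (iffP forallP) => h j; apply/implyP/h.
have linE : is_lincode E.
  apply/lincodeP; split=> [|u v /EP uE /EP vE|a u /EP uE]; apply/EP=> j; rewrite ffunE.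
  - by rewrite eqxx.
  - apply: contraR => jR.
    by rewrite (eqP (contraNT (uE j) jR)) (eqP (contraNT (vE j) jR)) addr0.
  - by rewrite mulf_eq0 => /norP[_ /uE].
have linD := dual_lincode C.
have linA : is_lincode A.
  apply/lincodeP; split.
  - by rewrite inE; apply/exists_inP; exists 0; rewrite ?subr0 lincode0.
  - move=> u v; rewrite !inE => /exists_inP[w wD uw] /exists_inP[w' wD' vw].
    apply/exists_inP; exists (w + w'); first exact: lincodeD.
    by rewrite opprD addrACA; apply: lincodeD.
  - move=> a u; rewrite !inE => /exists_inP[w wD uw].
    apply/exists_inP; exists [ffun j => a * w j]; first exact: lincodeZ.
    suff -> : [ffun j => a * u j] - [ffun j => a * w j] = [ffun j => a * (u - w) j].
      exact: lincodeZ.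
    by apply/ffunP=> j; rewrite !ffunE mulrBr.
have: delta i \in A.
  rewrite -(dualK linA); apply/dual_codeP=> c /dual_codeP cA; rewrite dotp_delta.
  have cC : c \in C.
    rewrite -(dualK linC); apply/dual_codeP=> w wD; apply: cA.
    by rewrite inE; apply/exists_inP; exists w; rewrite ?subrr ?lincode0.
  have /forall_inP/(_ 0 (lincode0 linC))/implyP := rec c cC; rewrite ffunE => h.
  apply/eqP/h/forall_inP=> j jR; rewrite ffunE -dotp_delta dotpC cA //.
  rewrite inE; apply/exists_inP; exists 0; rewrite ?lincode0 // subr0.
  by apply/EP=> j'; rewrite ffunE; case: (j' =P j) => [->|_] //; rewrite eqxx.
rewrite inE => /exists_inP[w wD /EP h]; exists w => //.
(* [delta i - w] is supported on [R], so [w] agrees with [delta i] off [R]; in particular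
   [w i = 1]. *)
have hN j : j \notin R -> w j = (j == i)%:R.
  move/(contraNN (h j)); rewrite negbK !ffunE subr_eq0 => /eqP <- //.
split; first by rewrite hN // eqxx oner_eq0.
move=> j; rewrite in_setU1; case: (boolP (j \in R)) => jR; first by rewrite orbT.
by rewrite orbF hN //; case: (j == i); rewrite ?eqxx.
Qed.

(** Pairing [w] with [u - v] leaves only the term at [i], and [w i] is invertible. *)
Lemma dual_recovers C i (R : {set I}) w : w \in dual_code C -> w i != 0 ->
  (forall j, w j != 0 -> j \in i |: R) -> recovers C i R.
Proof.
move=> /dual_codeP wC wi wR; apply/forall_inP=> u uC; apply/forall_inP=> v vC.
apply/implyP=> /forall_inP uv; apply/eqP/(mulfI wi)/eqP; rewrite -subr_eq0 -mulrBr.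
have: dotp w u - dotp w v = 0 by rewrite !wC ?subrr.
rewrite /dotp -sumrB (bigD1 i) //= big1 ?addr0 => [<-|j jNi]; first by rewrite mulrBr.
have [->|/wR] := eqVneq (w j) 0; first by rewrite !mul0r subrr.
by rewrite in_setU1 (negPf jNi) => /uv/eqP->; rewrite subrr.
Qed.

Lemma mindistP C d : reflect
  ((exists2 c, c \in C & c != 0 /\ wt c = d) /\
    {in C, forall c, c != 0 -> (d <= wt c)%N}) (has_mindist C d).
Proof.
apply: (iffP andP) => -[]; [move=> /exists_inP[c cC /andP[c0 /eqP cd]] /forall_inP h|].
  by split=> [|u uC u0]; [exists c|apply: (implyP (h u uC))].
case=> c cC [c0 cd] h; split; last by apply/forall_inP=> u /h/implyP.
by apply/exists_inP; exists c => //; rewrite c0 cd eqxx.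
Qed.

(** A dual word of weight [r.+1] through [i] yields a repair set of size [r] once [i] is removed.
    Conversely [recovers_dual] turns a repair set of size [r'] into a nonzero dual word of weight at
    most [r'.+1], so a single coordinate rules out [r' < r]. *)
Lemma locality_dual_mindist C r : is_lincode C -> (0 < #|I|)%N ->
    {in dual_code C, forall w, w != 0 -> (r.+1 <= wt w)%N} ->
    (forall i, exists2 w, w \in dual_code C & w i != 0 /\ wt w = r.+1) ->
  locality_is C r.
Proof.
move=> linC /card_gt0P[i0 _] dmin cover; split.
  apply/forallP=> i; have [w wD [wi wr]] := cover i.
  have iw : i \in [set j | w j != 0] by rewrite inE.
  apply/existsP; exists ([set j | w j != 0] :\ i); apply/and3P; split.
  - by rewrite !inE eqxx.
  - by move: wr; rewrite /wt (cardsD1 i) iw add1n => -[->].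
  - by apply: dual_recovers wD wi _ => j wj; rewrite setD1K // inE.
move=> r' ltr; apply/forallP=> /(_ i0)/existsP[R /and3P[iR /eqP cR rec]].
have [w wD [wi wR]] := recovers_dual linC iR rec.
have w0 : w != 0 by apply: contraNneq wi => ->; rewrite ffunE.
have := dmin w wD w0; rewrite /wt.
have: (#|[set j | w j != 0%R]| <= #|i0 |: R|)%N.
  by apply/subset_leq_card/subsetP=> j; rewrite inE => /wR.
rewrite cardsU1 iR cR add1n => le1 le2; have := leq_trans le2 le1.
by rewrite ltnS leqNgt ltr.
Qed.

(** Double counting of nonzero entries: every nonzero word contributes at least [d], while at each
    coordinate the kernel of evaluation has at most p cosets, so at least a fraction 1/p of the
    words vanish there. *)
Lemma plotkin C d : is_lincode C -> {in C, forall c, c != 0 -> (d <= wt c)%N} ->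
  (p * ((#|C| - 1) * d) <= #|I| * ((p - 1) * #|C|))%N.
Proof.
move=> linC dmin.
have : ((#|C| - 1) * d <= \sum_(c in C) wt c)%N.
  rewrite (bigD1 (0 : {ffun I -> 'F_p})) ?lincode0 //= (cardsD1 (0 : {ffun I -> 'F_p}) C) lincode0 // addKn.
  apply: leq_trans (leq_addl _ _); rewrite -sum_nat_const.
  rewrite [leqLHS](eq_bigl [pred c | (c \in C) && (c != 0)]); last first.
    by move=> c; rewrite !inE andbC.
  by apply: leq_sum => c /andP[cC /(dmin c cC)].
move/(leq_mul (leqnn p)) => h; apply: leq_trans h _.
under eq_bigr do rewrite /wt -sum1dep_card big_mkcond.
rewrite exchange_big /= big_distrr /= -sum_nat_const; apply: leq_sum => i _.
rewrite -big_mkcondr /= sum1_card.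
have := @card_fibers _ C (fun c => c i) linC.
set K := [set c in C | _] => cardC.
have {}cardC := cardC (fun u v _ _ => ltac:(by rewrite !ffunE subr_eq0)).
have leK : (#|C| <= p * #|K|)%N.
  by rewrite cardC leq_mul // -[leqRHS](card_Fp p_pr) max_card.
have : (#|[pred c in C | c i != 0%R]| + #|K| = #|C|)%N.
  rewrite -[RHS](cardID K) addnC; congr (_ + _)%N; apply: eq_card => c.
    by rewrite !inE ffunE; case: (c \in C); rewrite ?andbF ?andbT.
  by rewrite !inE ffunE; case: (c \in C); rewrite ?andbF ?andbT.
have := prime_gt1 p_pr; move: #|_| #|K| #|C| leK => x k c; nia.
Qed.

End Basics.

Section Puncturing.
Variables (I J : finType) (phi : J -> I).
Hypothesis phi_inj : injective phi.
Variable C : {set {ffun I -> 'F_p}}.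
Hypothesis linC : is_lincode C.

(** Puncturing is a pullback along an injection, so that the kept coordinates may be indexed by a
    subtype or by an ordinal. *)
Definition pull (c : {ffun I -> 'F_p}) : {ffun J -> 'F_p} := [ffun j => c (phi j)].
Definition punctured := pull @: C.

Lemma punctured_lincode : is_lincode punctured.
Proof.
apply/lincodeP; split.
- by apply/imsetP; exists 0; rewrite ?lincode0 //; apply/ffunP=> j; rewrite !ffunE.
- move=> _ _ /imsetP[u uC ->] /imsetP[v vC ->]; apply/imsetP; exists (u + v).
    exact: lincodeD.
  by apply/ffunP=> j; rewrite !ffunE.
- move=> a _ /imsetP[u uC ->]; apply/imsetP; exists [ffun i => a * u i].
    exact: lincodeZ.
  by apply/ffunP=> j; rewrite !ffunE.
Qed.

Lemma dual_punctured_extend w : w \in dual_code punctured ->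
  exists2 w', w' \in dual_code C & pull w' = w /\ wt w' = wt w.
Proof.
move=> /dual_codeP wP.
pose w' := [ffun i => \sum_(j | phi j == i) w j].
have w'phi j : w' (phi j) = w j.
  by rewrite ffunE (big_pred1 j) // => j'; rewrite (inj_eq phi_inj).
exists w'; last split.
- apply/dual_codeP=> c cC; have := wP _ (imset_f pull cC) => <-.
  rewrite /dotp (partition_big phi predT) //=; apply: eq_bigr => i _.
  by rewrite ffunE mulr_suml; apply: eq_bigr => j /eqP<-; rewrite ffunE.
- by apply/ffunP=> j; rewrite ffunE w'phi.
- rewrite /wt -(card_imset _ phi_inj); apply: eq_card => i; rewrite inE.
  apply/idP/imsetP=> [|[j]]; last by rewrite inE => wj ->; rewrite w'phi.
  rewrite ffunE => nz; case: (pickP (fun j => phi j == i)) => [j /eqP ji|no].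
    by exists j; rewrite ?ji // inE -w'phi ji ffunE.
  by move: nz; rewrite big_pred0 ?eqxx.
Qed.

(** The multiples of [g] all puncture to 0, so puncturing shrinks [C] by a factor of at least p, and
    the dual of the result grows accordingly. *)
Lemma card_dual_punctured g : g \in C -> g != 0 -> pull g = 0 ->
  (p ^ #|J|.+1 <= #|C| * #|dual_code punctured|)%N.
Proof.
move=> gC g0 gphi.
rewrite expnS -(card_dual punctured_lincode) mulnA leq_mul //.
rewrite [leqRHS](_ : _ = (#|punctured| * #|[set c in C | pull c == pull 0%R]|)%N); last first.
  apply: card_fibers linC _ => u v _ _.
  have -> : pull (u - v) = pull u - pull v by apply/ffunP=> j; rewrite !ffunE.
  have -> : pull 0 = 0 by apply/ffunP=> j; rewrite !ffunE.
  by rewrite subr_eq0.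
rewrite mulnC leq_mul //.
rewrite -[leqLHS](card_Fp p_pr).
rewrite -(card_imset _ (_ : injective (fun a : 'F_p => [ffun i => a * g i]))).
  apply/subset_leq_card/subsetP=> _ /imsetP[a _ ->]; rewrite inE lincodeZ //=.
  apply/eqP/ffunP=> j; move/ffunP/(_ j): gphi; rewrite !ffunE => ->.
  by rewrite mulr0.
move=> a b /ffunP E.
have [i gi] := word_neq0 g0.
by apply: (mulIf gi); have := E i; rewrite !ffunE.
Qed.

End Puncturing.

(** Two words agreeing on the first [m.+1 - d] coordinates differ in at most [d - 1] places, so
    keeping these coordinates is injective on [C]. The case [d = m.+1] keeps none: only the zero
    word is left. *)
Lemma singleton_bound m d (C : {set {ffun 'I_m -> 'F_p}}) : is_lincode C ->
    (0 < d <= m.+1)%N -> {in C, forall c, c != 0 -> (d <= wt c)%N} ->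
  (#|C| <= p ^ (m.+1 - d))%N.
Proof.
move=> linC /andP[d_gt0 le_d] dmin.
have lek : (m.+1 - d <= m)%N by lia.
rewrite -[X in (_ <= _ ^ X)%N]card_ord -card_words.
pose h := @pull _ _ (widen_ord lek).
have hi : {in C &, injective h}.
  move=> u v uC vC /ffunP E; apply/eqP; rewrite -subr_eq0; apply/negPn/negP=> nz.
  have := dmin _ (lincodeB linC uC vC) nz; rewrite leqNgt => /negP; apply.
  rewrite /wt; set S := [set i | _].
  have : (#|S| + #|[set widen_ord lek j | j in 'I_(m.+1 - d)]| <= #|'I_m|)%N.
    rewrite -cardsUI [X in (_ + X)%N](_ : _ = 0%N) ?addn0 ?max_card //.
    apply/eqP; rewrite cards_eq0; apply/eqP/setP=> i; rewrite !inE.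
    apply/negP=> /andP[nz_i /imsetP[j _ ij]]; have := E j; rewrite !ffunE -ij => uv.
    by move: nz_i; rewrite !ffunE uv subrr eqxx.
  rewrite card_imset ?card_ord; first lia.
  by move=> i j /(congr1 val) /= ij; apply: val_inj.
by rewrite -(card_in_imset hi) max_card.
Qed.

Lemma leq_kopt m d k :
    (forall C : {set {ffun 'I_m -> 'F_p}},
       is_lincode C -> {in C, forall c, c != 0 -> (d <= wt c)%N} -> (#|C| <= p ^ k)%N) ->
  (kopt p m d <= k)%N.
Proof.
move=> h; apply/bigmax_leqP=> C /andP[linC /mindistP[_ dmin]].
by rewrite -(leq_exp2l _ _ (prime_gt1 p_pr)) -card_lincode // h.
Qed.

Lemma kopt_geq m d k (C : {set {ffun 'I_m -> 'F_p}}) :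
  is_lincode C -> has_mindist C d -> (p ^ k <= #|C|)%N -> (k <= kopt p m d)%N.
Proof.
move=> linC Cd; rewrite card_lincode // leq_exp2l ?prime_gt1 // => /leq_trans; apply.
by apply: (@leq_bigmax_cond _ _ (@code_dim p 'I_m) C); rewrite linC.
Qed.

Lemma kopt_gt0 m d : (0 < d <= m)%N -> (0 < kopt p m d)%N.
Proof.
case/andP=> d_gt0 ledm; pose one : {ffun 'I_m -> 'F_p} := [ffun i : 'I_m => (i < d)%:R].
pose C := [set [ffun i => a * one i] | a : 'F_p].
have wtC (a : 'F_p) : a != 0 -> wt [ffun i => a * one i] = d.
  move=> a0; rewrite -[RHS]card_ord -(card_imset _ (_ : injective (widen_ord ledm))).
    apply: eq_card => i; rewrite !inE !ffunE mulf_eq0 (negPf a0) /=.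
    have -> : ((i < d)%:R != 0 :> 'F_p) = (i < d)%N.
      by case: (i < d)%N; rewrite ?oner_eq0 ?eqxx.
    apply/idP/imsetP=> [lti|[j _ ->] /=]; last exact: ltn_ord.
    by exists (Ordinal lti) => //; apply: val_inj.
  by move=> i j /(congr1 val) /= ij; apply: val_inj.
have CE (a : 'F_p) : [ffun i => a * one i] \in C by exact: imset_f.
have one1 : [ffun i => 1 * one i] != 0.
  have lt0m : (0 < m)%N by lia.
  apply/eqP=> /ffunP/(_ (Ordinal lt0m)); rewrite !ffunE /= d_gt0 mul1r => /eqP.
  by rewrite oner_eq0.
have linC : is_lincode C.
  apply/lincodeP; split=> [|_ _ /imsetP[a _ ->] /imsetP[b _ ->]|b _ /imsetP[a _ ->]].
  - by have := CE 0; congr (_ \in C); apply/ffunP=> i; rewrite !ffunE mul0r.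
  - by have := CE (a + b); congr (_ \in C); apply/ffunP=> i; rewrite !ffunE mulrDl.
  - by have := CE (b * a); congr (_ \in C); apply/ffunP=> i; rewrite !ffunE mulrA.
apply: (kopt_geq linC).
  apply/mindistP; split; first by exists [ffun i => 1 * one i] => //; rewrite wtC ?oner_eq0.
  move=> _ /imsetP[a _ ->] nz; rewrite wtC //; apply: contraNneq nz => ->.
  by apply/eqP/ffunP=> i; rewrite !ffunE mul0r.
rewrite expn1 card_imset ?card_Fp // => a b /ffunP E.
have [i] := word_neq0 one1.
by rewrite ffunE mul1r => nz; apply: (mulIf nz); have := E i; rewrite !ffunE.
Qed.

End LinearCodes.

(** * Rational relations between p-th roots of unity, and the quadratic character at -1 *)

Section PrimeField.

Variable p : nat.
Hypotheses (p_pr : prime p) (p_odd : odd p).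

Lemma sum_chi : \sum_(k : 'F_p) chi k = 0.
Proof.
set S := \sum_k _.
have : S = chi (1 : 'F_p) * S.
  rewrite /S mulr_sumr [LHS](reindex_inj (addrI 1)) /=.
  by apply: eq_bigr => k _; rewrite chiD.
move/eqP; rewrite -subr_eq0 -{1}[S]mul1r -mulrBl mulf_eq0 subr_eq0 eq_sym.
by rewrite chi_eq1 // oner_eq0 => /eqP.
Qed.

(* The minimal polynomial of zeta over Q has degree p - 1. *)
Lemma chi_relation_const (c : 'F_p -> rat) :
  \sum_k ratr (c k) * chi k = 0 -> forall k, c k = c ord_max.
Proof.
move=> rel; set n := (Zp_trunc (pdiv p)); have nE : n.+2 = p := Fp_cast p_pr.
(* Subtracting a multiple of [sum_chi] kills the coefficient of index p - 1 and leaves a polynomial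
   of degree at most p - 2 vanishing at [zeta p], which must be zero. *)
pose d (k : 'F_p) := c k - c ord_max.
have reld : \sum_(k : 'F_p) ratr (d k) * chi k = 0.
  under eq_bigr do rewrite rmorphB mulrBl.
  by rewrite sumrB rel -mulr_sumr sum_chi mulr0 subr0.
pose q := \poly_(i < n.+1) d (inZp i).
have [P [PE P_mon] Pdvd] := minCpolyP (zeta p).
have sizeP : size P = n.+2.
  have := size_cyclotomic (zeta p) p.
  rewrite -minCpoly_cyclotomic ?zeta_prim // PE size_map_poly totient_prime //.
  by rewrite prednK ?prime_gt0 // nE.
have q0 : q = 0.
  apply/eqP/negPn/negP=> nzq.
  have : P %| q.
    have qE : map_poly ratr q = \poly_(i < n.+1) (ratr (d (inZp i)) : algC).
      by apply/polyP=> i; rewrite coef_map !coef_poly /=; case: ifP => _ //; rewrite raddf0.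
    rewrite -Pdvd qE rootE horner_poly -[X in _ == X]reld.
    rewrite [in eqbRHS]big_ord_recr /= /d subrr rmorph0 mul0r addr0.
    apply/eqP/eq_bigr => i _; rewrite /chi /=.
    have lti : (i < n.+2)%N := ltnW (ltn_ord i).
    congr (ratr (c _ - _) * _); apply: val_inj => /=; rewrite modn_small //.
  move/(dvdp_leq nzq); rewrite sizeP => h; have := leq_trans h (size_poly _ _).
  by rewrite ltnn.
move=> k; apply/eqP; rewrite -subr_eq0 -/(d k).
have [ltk|] := ltnP k n.+1.
  have := congr1 (fun r : {poly rat} => r`_k) q0.
  by rewrite coef_poly ltk coef0 valZpK => ->.
move=> lek; suff -> : k = ord_max by rewrite /d subrr.
by apply: val_inj => /=; apply/eqP; rewrite eqn_leq lek -ltnS ltn_ord.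
Qed.

Lemma Fp_fermat (y : 'F_p) : y != 0 -> y ^+ (p - 1) = 1.
Proof.
move=> y0; apply: (mulfI y0).
rewrite mulr1 -exprS subn1 prednK ?prime_gt0 //.
by have := expf_card y; rewrite card_Fp.
Qed.

Lemma N1_neq1 : (-1 : 'F_p) != 1.
Proof.
have p_gt2 := odd_prime_gt2 p_odd p_pr.
rewrite eq_sym -subr_eq0 opprK -(natrD _ 1 1) -(dvdn_pcharf (pchar_Fp p_pr)).
by rewrite gtnNdvd.
Qed.

(** Euler's criterion at -1. It identifies the sign in [pstar] with [eta0 (-1)], so that the
    assumption on [eps] fixes the sign of the Walsh values. *)
Lemma eta0N1 : eta0 (-1 : 'F_p) = (-1) ^+ ((p - 1) %/ 2).
Proof.
set m := ((p - 1) %/ 2)%N.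
have p_gt2 := odd_prime_gt2 p_odd p_pr.
have mE : (p - 1 = 2 * m)%N by rewrite /m; lia.
rewrite /eta0 oppr_eq0 oner_eq0 -[RHS]signr_odd.
case: existsP => [[y /eqP y2]|nsq].
  have y0 : y != 0.
    by apply/eqP=> y0; move/eqP: y2; rewrite y0 expr0n eq_sym oppr_eq0 oner_eq0.
  have : (-1 : 'F_p) ^+ odd m = 1 by rewrite signr_odd -y2 -exprM -mE Fp_fermat.
  by case: (odd m) => // N11; case/eqP: N1_neq1.
case: (boolP (odd m)) => // m_even; case: nsq.
(* X^m - 1 has at most m roots among the 2m nonzero elements. A non-root has [y ^+ m = -1], and
   [y ^+ (m %/ 2)] is then a square root of -1. *)
have [y y0 ym] : exists2 y : 'F_p, y != 0 & y ^+ m != 1.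
  have [y] : exists y : 'F_p, (y != 0) && (y ^+ m != 1).
    apply/existsP; apply: contraT; rewrite negb_exists => /forallP all1.
    have m_gt0 : (0 < m)%N by lia.
    have : (size (enum [pred y : 'F_p | y != 0%R]) < size ('X^m - 1%:P : {poly 'F_p})%R)%N.
      apply: max_poly_roots; last exact: enum_uniq.
        by rewrite -size_poly_eq0 size_XnsubC.
      apply/allP=> y; rewrite mem_enum inE => y0.
      have := all1 y; rewrite y0 negbK => /eqP ym.
      by rewrite rootE !hornerE ym subrr.
    rewrite size_XnsubC // -cardE.
    have := cardC1 (0 : 'F_p); rewrite card_Fp //.
    rewrite (eq_card (B := [pred y : 'F_p | y != 0%R])) //.
    move=> ->; lia.
  by case/andP=> y0 ym; exists y.
exists (y ^+ (m %/ 2)); rewrite -exprM.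
have -> : (m %/ 2 * 2 = m)%N by lia.
have := Fp_fermat y0; rewrite mE mulnC exprM => /eqP; rewrite sqrf_eq1.
by rewrite (negPf ym).
Qed.

End PrimeField.

(** * The trace from the field of p^2 elements *)

Section Trace.

Variables (p : nat) (L : finFieldType).
Hypotheses (p_pr : prime p) (cardL : #|L| = (p ^ 2)%N).

Let iota : 'F_p -> L := Fp_to L.
Let tr : L -> 'F_p := @trace_Fp p 2 L.

Lemma pcharL : p \in [pchar L]. Proof. exact: card_finPcharP cardL p_pr. Qed.

Lemma Fp_toD a b : iota (a + b) = iota a + iota b.
Proof.
rewrite /iota /Fp_to -natrD -[RHS](GRing.natr_mod_pchar pcharL) /=.
by rewrite -[in LHS](GRing.natr_mod_pchar pcharL) modn_dvdm // Fp_cast.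
Qed.

Lemma Fp_toM a b : iota (a * b) = iota a * iota b.
Proof.
rewrite /iota /Fp_to -natrM -[RHS](GRing.natr_mod_pchar pcharL) /=.
by rewrite -[in LHS](GRing.natr_mod_pchar pcharL) modn_dvdm // Fp_cast.
Qed.

Lemma Fp_to_inj : injective iota.
Proof.
have inj0 a : iota a = 0 -> a = 0.
  move/eqP; rewrite /iota /Fp_to -(dvdn_pcharf pcharL) => dvd; apply: val_inj => /=.
  have ltap : (nat_of_ord a < p)%N by rewrite -[X in (_ < X)%N](Fp_cast p_pr).
  by case: (posnP a) => // a_gt0; move: dvd; rewrite gtnNdvd.
move=> a b eab; apply/eqP; rewrite -subr_eq0; apply/eqP/inj0.
apply: (addIr (iota b)); rewrite -Fp_toD subrK add0r //.
Qed.

Lemma Fp_to_frob a : iota a ^+ p = iota a.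
Proof.
rewrite /iota /Fp_to.
by rewrite -(pFrobenius_autE pcharL) pFrobenius_aut_nat.
Qed.

Lemma frob_fixed y : y ^+ p = y -> exists k, iota k = y.
Proof.
move=> yp; case: (pickP (fun k => iota k == y)) => [k /eqP|no]; first by exists k.
have p_gt1 := prime_gt1 p_pr.
have szP : size ('X^p - 'X : {poly L}) = p.+1.
  by rewrite size_polyDl ?size_polyXn // size_polyN size_polyX.
have : (size (y :: [seq iota k | k : 'F_p]) < size ('X^p - 'X : {poly L})%R)%N.
  apply: max_poly_roots; first by rewrite -size_poly_eq0 szP.
    apply/allP=> z; rewrite inE => /orP[/eqP->|/mapP[k _ ->]];
      by rewrite rootE !hornerE ?yp ?Fp_to_frob subrr.
  rewrite cons_uniq map_inj_uniq ?enum_uniq ?andbT; last exact: Fp_to_inj.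
  by apply/mapP=> -[k _ /esym/eqP]; rewrite no.
by rewrite szP /= size_map -cardE card_Fp // ltnn.
Qed.

Lemma frobD (x y : L) : (x + y) ^+ p = x ^+ p + y ^+ p.
Proof. by rewrite exprDn_pchar // pnatE // pcharL. Qed.

Lemma frobK (x : L) : (x ^+ p) ^+ p = x.
Proof. by rewrite -exprM mulnn -cardL expf_card. Qed.

(** Since x^(p^2) = x, the sum x + x^p is fixed by Frobenius and lies in the prime field: the
    default 0 of [trace_Fp] is never taken. *)
Lemma Fp_to_trace x : iota (tr x) = x + x ^+ p.
Proof.
rewrite /tr /trace_Fp; case: pickP => [k /eqP kE|no].
  by rewrite /iota /= kE !big_ord_recl big_ord0 expn0 expn1 expr1 addr0.
have [k kE] : exists k, iota k = x + x ^+ p.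
  by apply: frob_fixed; rewrite frobD frobK addrC.
have := no k; rewrite !big_ord_recl big_ord0 expn0 expn1 expr1 addr0.
by rewrite -/(iota k) kE eqxx.
Qed.

Lemma traceD x y : tr (x + y) = tr x + tr y.
Proof. by apply: Fp_to_inj; rewrite Fp_toD !Fp_to_trace frobD addrACA. Qed.

Lemma traceZ a x : tr (iota a * x) = a * tr x.
Proof. by apply: Fp_to_inj; rewrite Fp_toM !Fp_to_trace exprMn Fp_to_frob mulrDr. Qed.

Lemma trace0 : tr 0 = 0.
Proof. by apply: (addrI (tr 0)); rewrite -traceD !addr0. Qed.

Lemma traceN x : tr (- x) = - tr x.
Proof. by apply: (addrI (tr x)); rewrite -traceD !subrr trace0. Qed.

(** X^p + X has degree p < p^2, so some trace is nonzero; linearity over the prime field then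
    reaches every value. *)
Lemma trace_surj k : exists x, tr x = k.
Proof.
have p_gt1 := prime_gt1 p_pr.
have [t t0] : exists t, tr t != 0.
  apply/existsP; apply: contraT; rewrite negb_exists => /forallP all0.
  have szP : size ('X^p + 'X : {poly L}) = p.+1.
    by rewrite size_polyDl ?size_polyXn // size_polyX.
  have : (size (enum L) < size ('X^p + 'X : {poly L})%R)%N.
    apply: max_poly_roots; [by rewrite -size_poly_eq0 szP| |exact: enum_uniq].
    apply/allP=> z _; rewrite rootE !hornerE addrC -Fp_to_trace.
    by have := all0 z; rewrite negbK => /eqP->.
  rewrite szP -cardE cardL; nia.
exists (iota (k / tr t) * t).
by rewrite traceZ divfK.
Qed.

Lemma card_trace_fiber k : #|[set x | tr x == k]| = p.
Proof.
have E l : #|[set x | tr x == l]| = #|[set x | tr x == 0]|.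
  have [y <-] := trace_surj l.
  rewrite -(card_imset [set x | tr x == 0] (addIr y)); apply: eq_card => x.
  rewrite inE; apply/eqP/imsetP=> [xy|[z]].
    by exists (x - y); rewrite ?subrK // inE traceD traceN xy subrr.
  by rewrite inE => /eqP z0 ->; rewrite traceD z0 add0r.
have : (\sum_(l : 'F_p) #|[set x | tr x == l]| = p ^ 2)%N.
  rewrite -cardL -sum1_card (partition_big tr predT) //=; apply: eq_bigr => l _.
  by rewrite -sum1dep_card.
rewrite (eq_bigr _ (fun l _ => E l)) sum_nat_const card_Fp // -(E k).
have := prime_gt0 p_pr; nia.
Qed.

(** Supplies a nonconstant word without [f] term that takes equal values at two given points. *)
Lemma trace_ker_nontrivial (y : L) : y != 0 -> exists2 t, t != 0 & tr (t * y) = 0.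
Proof.
move=> y0.
have := card_trace_fiber 0; rewrite (cardsD1 0) inE trace0 eqxx.
have := prime_gt1 p_pr => p1 cE.
have /card_gt0P[t] : (0 < #|[set x | tr x == 0%R] :\ 0%R|)%N.
  by move: p1; rewrite -[X in (1 < X)%N]cE add1n ltnS.
rewrite !inE => /andP[t0 /eqP tt]; exists (t / y); last by rewrite divfK.
by rewrite mulf_neq0 ?invr_eq0.
Qed.

End Trace.

(** Padding device: it enlarges a small dual support to a pair of points, and a single point to four
    zeros of one word. *)
Lemma intermediate_set (T : finType) (A Z : {set T}) k :
    A \subset Z -> (#|A| <= k <= #|Z|)%N ->
  exists B : {set T}, [/\ A \subset B, B \subset Z & #|B| = k].
Proof.
move: {2}(k - #|A|)%N (erefl (k - #|A|)%N) => n.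
elim: n A => [|n IHn] A kA sAZ /andP[leA leZ]; first by exists A; split=> //; lia.
have /card_gt0P[u] : (0 < #|Z :\: A|)%N by rewrite cardsD (setIidPr sAZ); lia.
rewrite inE => /andP[uA uZ].
have cuA : #|u |: A| = #|A|.+1 by rewrite cardsU1 uA.
have [|||B [sB BZ cB]] := IHn (u |: A); rewrite ?cuA; try lia.
  by rewrite subUset sub1set uZ.
by exists B; split=> //; apply: subset_trans sB; apply: subsetUr.
Qed.

(** * The code of [f]: zeros of its words, geometry and dual distance *)

Section BentCode.

Variables (p : nat) (L : finFieldType) (f : L -> 'F_p) (fstar : L -> 'F_p).
Hypotheses (p_pr : prime p) (p_odd : odd p) (cardL : #|L| = (p ^ 2)%N).
Hypothesis walsh : forall b,
  \sum_x chi (f x - trace_Fp p 2 (b * x)) = - p%:R * chi (fstar b).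

Let tr : L -> 'F_p := @trace_Fp p 2 L.
Let iota : 'F_p -> L := Fp_to L.
Let p_gt2 : (2 < p)%N := odd_prime_gt2 p_odd p_pr.

Lemma bent_fiber b k :
  #|[set x | f x - tr (b * x) == k]| = if k == fstar b then 1%N else p.+1.
Proof.
pose N k := #|[set x | f x - tr (b * x) == k]|.
(* Adding p at [fstar b] absorbs the Walsh value [- p%:R * chi (fstar b)], so the counts [c] satisfy
   a rational relation and are all equal; they total p^2 + p, hence each is p + 1. *)
pose c k : nat := (N k + p * (k == fstar b))%N.
have rel : \sum_l ratr (c l)%:R * chi l = 0.
  under eq_bigr do rewrite ratr_nat natrD mulrDl.
  rewrite big_split /=.
  have -> : \sum_l (N l)%:R * chi l = \sum_x chi (f x - tr (b * x)).
    rewrite [RHS](partition_big (fun x => f x - tr (b * x)) predT) //=.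
    apply: eq_bigr => l _; rewrite [RHS](eq_bigr (fun=> chi l)) => [|x /eqP->//].
    by rewrite sumr_const mulr_natl; congr (_ *+ _); apply: eq_card => x; rewrite !inE.
  rewrite walsh (bigD1 (fstar b)) //= eqxx muln1 [X in _ + (_ + X)]big1 ?addr0.
    by rewrite mulNr addNr.
  by move=> l /negPf->; rewrite muln0 mul0r.
have cE l : c l = c ord_max.
  apply/eqP; rewrite -(eqr_nat rat); apply/eqP.
  exact: (chi_relation_const p_pr (c := fun k => (c k)%:R) rel l).
have : (\sum_l c l = p ^ 2 + p)%N.
  rewrite big_split /=; congr (_ + _)%N.
    rewrite -cardL -sum1_card (partition_big (fun x => f x - tr (b * x)) predT) //=.
    by apply: eq_bigr => l _; rewrite /N -sum1dep_card.
  by rewrite (bigD1 (fstar b)) //= eqxx muln1 big1 ?addn0 // => l /negPf->; rewrite muln0.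
rewrite (eq_bigr _ (fun l _ => cE l)) sum_nat_const card_Fp // -(cE k) /c /N.
move: #|_| => n; case: eqP => _ /=; nia.
Qed.

Definition cw (a : 'F_p) (b : L) (c : 'F_p) : {ffun L -> 'F_p} := [ffun x => a * f x + tr (b * x) + c].

Notation C := (code_f 2 f).

Lemma code_fP w : reflect (exists a b c, w = cw a b c) (w \in C).
Proof.
rewrite inE; apply: (iffP existsP) => [[a /existsP[b /existsP[c /eqP->]]]|[a [b [c ->]]]].
  by exists a, b, c.
by exists a; apply/existsP; exists b; apply/existsP; exists c.
Qed.

Lemma cw_code a b c : cw a b c \in C.
Proof. by apply/code_fP; exists a, b, c. Qed.

Lemma cwD a b c a' b' c' : cw a b c + cw a' b' c' = cw (a + a') (b + b') (c + c').
Proof. by apply/ffunP=> x; rewrite !ffunE mulrDl [(b + _) * _]mulrDl /tr traceD //; ring. Qed.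

Lemma cwZ s a b c : [ffun x => s * cw a b c x] = cw (s * a) (iota s * b) (s * c).
Proof. by apply/ffunP=> x; rewrite !ffunE -[iota s * b * x]mulrA /tr /iota traceZ //; ring. Qed.

Lemma code_f_lincode : is_lincode C.
Proof.
apply/lincodeP; split.
- have := cw_code 0 0 0; congr (_ \in C).
  by apply/ffunP=> x; rewrite !ffunE !mul0r /tr trace0 // !addr0.
- move=> _ _ /code_fP[a [b [c ->]]] /code_fP[a' [b' [c' ->]]].
  by rewrite cwD cw_code.
- by move=> s _ /code_fP[a [b [c ->]]]; rewrite cwZ cw_code.
Qed.

Definition zeros (w : {ffun L -> 'F_p}) := [set x | w x == 0].

Lemma wt_zeros w : (wt w + #|zeros w| = p ^ 2)%N.
Proof.
rewrite -cardL -[RHS](cardC (zeros w)) addnC; congr (_ + _)%N.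
by apply: eq_card => x; rewrite !inE.
Qed.

Lemma zeros_bent a b c : a != 0 ->
  #|zeros (cw a b c)| = if - c / a == fstar (- b / iota a) then 1%N else p.+1.
Proof.
move=> a0; rewrite -bent_fiber; apply: eq_card => x; rewrite !inE ffunE.
have ia0 : iota a != 0.
  apply: contraNneq a0 => ia; apply/eqP/(Fp_to_inj p_pr cardL).
  by rewrite -/iota ia.
have {1}-> : b * x = iota a * (b / iota a * x) by rewrite mulrA mulrCA divff ?mulr1.
rewrite /tr traceZ // mulNr mulNr traceN // opprK -mulrDr -/tr.
by rewrite addr_eq0 -[RHS](inj_eq (mulfI a0)) [a * (- c / a)]mulrCA divff ?mulr1.
Qed.

Lemma zeros_bent_cases a b c : a != 0 ->
  #|zeros (cw a b c)| = 1%N \/ #|zeros (cw a b c)| = p.+1.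
Proof. by move=> a0; rewrite zeros_bent //; case: ifP => _; [left|right]. Qed.

Lemma zeros_trace b c : b != 0 -> #|zeros (cw 0 b c)| = p.
Proof.
move=> b0; rewrite -[RHS](card_trace_fiber p_pr cardL (- c)).
rewrite -(card_imset (zeros _) (mulfI b0)); apply: eq_card => y; rewrite inE.
apply/imsetP/idP=> [[x]|yc]; last exists (b^-1 * y); rewrite ?mulVKf //.
  by rewrite inE ffunE mul0r add0r addr_eq0 => h ->.
by rewrite inE ffunE mul0r add0r addr_eq0 mulVKf.
Qed.

Lemma zeros_const c : c != 0 -> #|zeros (cw 0 0 c)| = 0%N.
Proof.
move=> c0; apply/eqP; rewrite cards_eq0; apply/eqP/setP=> x; rewrite !inE ffunE.
by rewrite !mul0r /tr trace0 // !add0r (negPf c0).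
Qed.

Lemma zeros_code_le a b c : (a, b, c) != 0 -> (#|zeros (cw a b c)| <= p.+1)%N.
Proof.
have [->|a0] := eqVneq a 0; last by case: (zeros_bent_cases b c a0) => ->; lia.
have [->|b0] := eqVneq b 0; last by rewrite zeros_trace.
by have [->|c0] := eqVneq c 0; rewrite ?eqxx // zeros_const.
Qed.

Lemma zeros0 : #|zeros 0| = (p ^ 2)%N.
Proof. by rewrite -cardL; apply: eq_card => x; rewrite !inE ffunE eqxx. Qed.

Lemma cw_inj : injective (fun abc => cw abc.1.1 abc.1.2 abc.2).
Proof.
move=> [[a b] c] [[a' b'] c'] /= E; apply/eqP; rewrite -subr_eq0; apply/negPn/negP=> nz.
have := zeros_code_le nz.
have -> : cw (a - a') (b - b') (c - c') = 0.
  apply/ffunP=> x; have /ffunP/(_ x) := E; rewrite !ffunE => Ex.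
  rewrite !mulrBl /tr traceD // traceN //; rewrite /tr in Ex.
  transitivity ((a * f x + trace_Fp p 2 (b * x) + c)
    - (a' * f x + trace_Fp p 2 (b' * x) + c')); last by rewrite Ex subrr.
  ring.
rewrite zeros0; move: p_gt2; nia.
Qed.

Lemma card_code_f : #|C| = (p ^ 4)%N.
Proof.
have -> : C = [set cw abc.1.1 abc.1.2 abc.2 | abc : 'F_p * L * 'F_p].
  apply/setP=> w; apply/code_fP/imsetP=> [[a [b [c ->]]]|[[[a b] c] _ ->]].
    by exists (a, b, c).
  by exists a, b, c.
rewrite (card_imset _ cw_inj) !card_prod card_Fp // cardL.
by rewrite -expnS -expnSr.
Qed.

Lemma code_f_mindist w : w \in C -> w != 0 -> (p ^ 2 - p - 1 <= wt w)%N.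
Proof.
case/code_fP=> a [b [c ->]] nz.
have abc0 : (a, b, c) != 0.
  apply: contraNneq nz => -[-> -> ->]; apply/eqP/ffunP=> x.
  by rewrite !ffunE !mul0r /tr trace0 // !addr0.
have := zeros_code_le abc0; have := wt_zeros (cw a b c); lia.
Qed.

Lemma code_f_cover x : exists2 w, w \in C & w x != 0 /\ #|zeros w| = p.+1.
Proof.
(* For [cw 1 0 c], having p + 1 zeros excludes [c = - fstar 0], and not vanishing at [x] excludes
   [c = - f x]; p > 2 leaves a choice. *)
pose s := [:: - fstar 0; - f x].
have [c] : exists c : 'F_p, c \notin s.
  apply/existsP; apply: contraT; rewrite negb_exists => /forallP all_in.
  have : (#|'F_p| <= #|s|)%N.
    by apply/subset_leq_card/subsetP=> c _; have := all_in c; rewrite negbK.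
  by move/leq_trans/(_ (card_size s)); rewrite card_Fp // leqNgt p_gt2.
rewrite !inE => /norP[c1 c2]; exists (cw 1 0 c); first exact: cw_code.
split; first by rewrite ffunE mul1r mul0r /tr trace0 // addr0 addrC addr_eq0.
rewrite zeros_bent ?oner_eq0 // divr1 oppr0 mul0r ifN // eqr_oppLR //.
Qed.

(** Surjectivity of the trace gives a plane through the two graph points with coefficient 1 at [f];
    two distinct zeros rule out the fibre size 1. *)
Lemma secant x y : x != y ->
  exists b c, [/\ cw 1 b c x = 0, cw 1 b c y = 0 & #|zeros (cw 1 b c)| = p.+1].
Proof.
move=> xy; have xy0 : x - y != 0 by rewrite subr_eq0.
have [t tE] := trace_surj p_pr cardL (f y - f x).
pose b := t / (x - y); pose c := - f x - tr (b * x).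
have bxy : tr (b * x) - tr (b * y) = f y - f x.
  by rewrite -tE /tr -traceN // -traceD // -mulrBr divfK.
have Gx : cw 1 b c x = 0 by rewrite ffunE /c; ring.
have Gy : cw 1 b c y = 0.
  rewrite ffunE /c; transitivity ((f y - f x) - (tr (b * x) - tr (b * y))); first ring.
  by rewrite bxy subrr.
exists b, c; split=> //.
have [] // := zeros_bent_cases b c (oner_neq0 'F_p).
have : (#|[set x; y]| <= #|zeros (cw 1%R b c)|)%N.
  apply/subset_leq_card/subsetP=> u; rewrite !inE => /orP[]/eqP->; apply/eqP; assumption.
by rewrite cards2 xy => le2 e1; rewrite e1 in le2.
Qed.

(* Count incidences in the pencil G - s T of words vanishing at x and y, where T
   does not involve f: each member with s in F_p has p + 1 zeros. *)
Lemma no_three_collinear x y z : x != y -> z \notin [set x; y] ->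
  exists g, [/\ g \in C, g x = 0, g y = 0 & g z != 0].
Proof.
move=> xy zxy; have xy0 : x - y != 0 by rewrite subr_eq0.
have [b [c [Gx Gy _]]] := secant xy.
have [d d0 dxy] := trace_ker_nontrivial p_pr cardL xy0.
pose e := - tr (d * x); pose G := cw 1 b c; pose T := cw 0 d e.
have Tx : T x = 0 by rewrite ffunE /e; ring.
have Ty : T y = 0.
  rewrite ffunE /e mul0r add0r -/tr; apply/eqP; rewrite subr_eq0 eq_sym -subr_eq0.
  by rewrite /tr -traceN // -traceD // -mulrBr dxy.
have [|Gz] := eqVneq (G z) 0; last by exists G; rewrite cw_code.
have [|Tz] := eqVneq (T z) 0; last by exists T; rewrite cw_code.
move=> Tz Gz; exfalso.
pose H s := cw 1 (b + iota (- s) * d) (c - s * e).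
have HE s u : H s u = G u - s * T u.
  rewrite !ffunE mulrDl -[iota _ * d * u]mulrA /tr traceD // traceZ //; ring.
have cH s : #|zeros (H s)| = p.+1.
  have [] // := zeros_bent_cases (b + iota (- s) * d) (c - s * e) (oner_neq0 'F_p).
  have : (#|[set x; y]| <= #|zeros (H s)|)%N.
    apply/subset_leq_card/subsetP=> u; rewrite !inE => /orP[]/eqP->; rewrite HE;
      by rewrite ?Gx ?Gy ?Tx ?Ty mulr0 subr0.
  by rewrite cards2 xy => le2 e1; rewrite /H e1 in le2.
(* [S] is the base locus of the pencil. Its points are zeros of all p members, the other zeros of
   [T] of none, and the remaining points of exactly one. So p (p + 1) = (p^2 - p) + p #|S|, whence
   #|S| = 2, although [x], [y], [z] all lie in [S]. *)
pose S := [set u | (T u == 0) && (G u == 0)].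
have : (\sum_s #|zeros (H s)| = wt T + p * #|S|)%N.
  have cardE (W : finType) (P : pred W) : #|[set u | P u]| = (\sum_u P u)%N.
    by rewrite -sum1dep_card big_mkcond; apply: eq_bigr => u _; case: (P u).
  rewrite /wt /S !cardE; under eq_bigr do rewrite cardE.
  rewrite exchange_big big_distrr -big_split /=.
  apply: eq_bigr => u _; rewrite -cardE.
  have [Tu|Tu] := eqVneq (T u) 0; rewrite /= ?muln0 ?muln1 ?addn0 ?add0n.
    have [Gu|Gu] := eqVneq (G u) 0; rewrite ?muln1 ?muln0.
      rewrite -[RHS](card_Fp p_pr) -cardsT; apply: eq_card => s.
      by rewrite !inE HE Gu Tu mulr0 subr0 eqxx.
    apply/eqP; rewrite cards_eq0; apply/eqP/setP=> s.
    by rewrite !inE HE Tu mulr0 subr0 (negPf Gu).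
  rewrite -(cards1 (G u / T u)); apply: eq_card => s; rewrite !inE HE subr_eq0.
  by rewrite eq_sym -(inj_eq (mulIf Tu) s) divfK.
rewrite (eq_bigr _ (fun s _ => cH s)) sum_nat_const card_Fp //.
have := wt_zeros T; rewrite zeros_trace //.
have : (#|[set z; x; y]| <= #|S|)%N.
  apply/subset_leq_card/subsetP=> u; rewrite !inE -orbA.
  by case/or3P=> /eqP->; rewrite ?Tx ?Ty ?Gx ?Gy ?Tz ?Gz eqxx.
rewrite -setUA cardsU1 zxy cards2 xy.
by move: #|S| (wt T) p_gt2 => n m; nia.
Qed.

(** With weight at most 3, the support apart from [z] fits in a pair avoiding [z]; a code word
    vanishing on the pair but not at [z] then pairs with [w] to a nonzero value. *)
Lemma dual_mindist w : w \in dual_code C -> w != 0 -> (4 <= wt w)%N.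
Proof.
move=> /dual_codeP wC w0; rewrite leqNgt; apply/negP=> ltw.
have [z wz] := word_neq0 w0.
pose A := [set x | w x != 0] :\ z.
have cA : (#|A| <= 2)%N.
  by move: ltw; rewrite /wt (cardsD1 z) inE wz add1n !ltnS.
have [||B [sAB BZ /eqP/cards2P[x [y [xy BE]]]]] := @intermediate_set _ A [set~ z] 2.
- by apply/subsetP=> u; rewrite !inE => /andP[].
- by rewrite cA cardsC1 cardL; move: p_gt2; nia.
have zB : z \notin [set x; y].
  by rewrite -BE; apply/negP=> /(subsetP BZ); rewrite !inE eqxx.
have [g [gC gx gy gz]] := no_three_collinear xy zB.
have := wC g gC; rewrite /dotp (bigD1 z) //= big1 ?addr0 => [/eqP|u uz].
  by rewrite mulf_eq0 (negPf wz) (negPf gz).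
have [->|wu] := eqVneq (w u) 0; first by rewrite mul0r.
have : u \in B by apply: (subsetP sAB); rewrite !inE uz.
by rewrite BE !inE => /orP[]/eqP->; rewrite ?gx ?gy mulr0.
Qed.

(** Four zeros of a secant word, [x] among them, exist because p + 1 >= 4. The code restricted to
    them has at most p^3 words, so a nonzero dual word lives there, and [dual_mindist] forces its
    support to be all four points. *)
Lemma dual_cover x : exists2 w, w \in dual_code C & w x != 0 /\ wt w = 4%N.
Proof.
have [y] : exists y, y \in [set~ x].
  by apply/card_gt0P; rewrite cardsC1 cardL; move: p_gt2; nia.
rewrite !inE eq_sym => xy; have [b [c [Gx Gy cG]]] := secant xy.
set g := cw 1 b c in Gx Gy cG.
have [||B [xB Bz cB]] := @intermediate_set _ [set x] (zeros g) 4.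
- by rewrite sub1set inE Gx.
- by rewrite cards1 cG; move: p_gt2; lia.
pose phi (u : {u | u \in B}) : L := val u.
have cJ : #|{: {u | u \in B}}| = 4%N by rewrite card_sig.
have gphi : pull phi g = 0.
  apply/ffunP=> -[u uB]; rewrite [LHS]ffunE [RHS]ffunE.
  by have := subsetP Bz u uB; rewrite inE => /eqP.
have g0 : g != 0.
  by apply/eqP=> g0; move: cG; rewrite g0 zeros0; move: p_gt2; nia.
have := card_dual_punctured p_pr code_f_lincode (cw_code 1 b c) g0 gphi.
rewrite cJ card_code_f expnS mulnC leq_pmul2l ?expn_gt0 ?prime_gt0 // => leD.
have [w wD w0] : exists2 w, w \in dual_code (punctured phi C) & w != 0.
  have /card_gt1P[u [v [uD vD uv]]] : (1 < #|dual_code (punctured phi C)|)%N.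
    by apply: leq_trans leD; apply: prime_gt1.
  by have [u0|] := eqVneq u 0; [exists v; rewrite // -u0 eq_sym|exists u].
have [w' w'D [w'w wtw]] := dual_punctured_extend val_inj wD.
have w'0 : w' != 0.
  by apply: contraNneq w0 => E; rewrite -w'w E; apply/eqP/ffunP=> j; rewrite !ffunE.
have le4 := dual_mindist w'D w'0.
have wt4 : wt w' = 4%N.
  by apply/eqP; rewrite eqn_leq le4 andbT wtw -cJ max_card.
exists w' => //; split=> //.
have xB' : x \in B by rewrite -sub1set.
have : [set j | w j != 0] = setT.
  apply/eqP; rewrite eqEcard subsetT cardsT.
  by rewrite [leqLHS]cJ -[leqLHS]wt4 wtw leqnn.
by move/setP/(_ (exist _ x xB')); rewrite !inE -w'w ffunE.
Qed.

Lemma kopt_p1_4 : kopt p p.+1 4 = (p - 2)%N.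
Proof.
apply/eqP; rewrite eqn_leq; apply/andP; split.
  apply: leq_kopt => // D linD dmin.
  have -> : (p - 2 = p.+2 - 4)%N by lia.
  by apply: singleton_bound => //; move: p_gt2; lia.
have [w wC [_ zw]] := code_f_cover 0.
pose phi (i : 'I_p.+1) := enum_val (cast_ord (esym zw) i).
have phi_inj : injective phi by move=> i j /enum_val_inj/cast_ord_inj.
have wphi : pull phi w = 0.
  apply/ffunP=> i; rewrite !ffunE; have := enum_valP (cast_ord (esym zw) i).
  by rewrite inE => /eqP.
have w0 : w != 0.
  by apply/eqP=> w0; have := zw; rewrite w0 zeros0; move: p_gt2; nia.
have := card_dual_punctured p_pr code_f_lincode wC w0 wphi.
rewrite card_code_f card_ord.
have -> : (p.+2 = 4 + (p - 2))%N by move: p_gt2; lia.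
rewrite expnD leq_pmul2l ?expn_gt0 ?prime_gt0 // => leD.
have dmin v : v \in dual_code (punctured phi C) -> v != 0 -> (4 <= wt v)%N.
  move=> vD v0; have [v' v'D [v'v <-]] := dual_punctured_extend phi_inj vD.
  apply: dual_mindist => //; apply: contraNneq v0 => E.
  by rewrite -v'v E; apply/eqP/ffunP=> j; rewrite !ffunE.
apply: (kopt_geq p_pr _ _ leD); first exact: dual_lincode.
apply/mindistP; split; last exact: dmin.
(* [kopt] asks for distance exactly 4: without a word of weight 4 the distance would be at least 5,
   and Singleton would allow only p^(p - 3) words. *)
case: (pickP [pred v in dual_code (punctured phi C) | (v != 0) && (wt v == 4)]).
  by move=> v /= /and3P[vD v0 /eqP v4]; exists v.
move=> none; exfalso.
have := @singleton_bound p p_pr p.+1 5 _ (dual_lincode (punctured phi C)).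
have -> : (0 < 5 <= p.+2)%N by move: p_gt2; lia.
move=> /(_ isT) h; have /h : {in dual_code (punctured phi C), forall c, c != 0 -> (5 <= wt c)%N}.
  move=> v vD v0; rewrite ltn_neqAle dmin // andbT eq_sym.
  by have := none v; rewrite /= vD v0 => /= ->.
move/(leq_trans leD); rewrite leq_exp2l ?prime_gt1 //; move: p_gt2; lia.
Qed.

End BentCode.

(** For N words the Plotkin average amounts to N (3 p - 4) <= p (p^2 - p - 1), which fails as soon
    as N >= p^2. *)
Lemma kopt_eq1 p : prime p -> odd p -> kopt p (p ^ 2 - 4) (p ^ 2 - p - 1) = 1%N.
Proof.
move=> p_pr p_odd; have p_gt2 := odd_prime_gt2 p_odd p_pr.
apply/eqP; rewrite eqn_leq; apply/andP; split; last by apply: kopt_gt0 => //; nia.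
apply: leq_kopt => // D linD dmin.
have := plotkin p_pr linD dmin; rewrite card_ord card_lincode // expn1.
case: (code_dim D) => [|[|k]] pl; rewrite ?expn0 ?expn1 //; first lia.
exfalso; have : (p ^ 2 <= p ^ k.+2)%N by rewrite (leq_exp2l _ _ (prime_gt1 p_pr)).
move: pl; move: (p ^ k.+2)%N => N; clear -p_gt2.
have -> : p = (p - 3 + 3)%N by lia.
move: (p - 3)%N => q {p_gt2 p} pl leN.
have NE : (N = N - (q + 3) ^ 2 + (q + 3) ^ 2)%N by lia.
move: pl; rewrite NE; move: (N - _)%N => M.
have -> : ((q + 3) ^ 2 - (q + 3) - 1 = q ^ 2 + 5 * q + 5)%N by lia.
have -> : ((q + 3) ^ 2 - 4 = q ^ 2 + 6 * q + 5)%N by lia.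
have -> : (q + 3 - 1 = q + 2)%N by lia.
have -> : (M + (q + 3) ^ 2 - 1 = M + q ^ 2 + 6 * q + 8)%N by lia.
nia.
Qed.

(** * Parameters and optimality of the code and its dual *)

Unset Implicit Arguments.

Theorem theorem4p9 (p : nat) (L : finFieldType) (f : L -> 'F_p)
    (eps : algC) (fstar : L -> 'F_p) :
  prime p -> odd p -> #|L| = (p ^ 2)%N ->
  in_RF 2 f -> weakly_regular_bent 2 f eps fstar ->
  eps * eta0 (-1 : 'F_p) = -1 ->
  [/\ is_LRC (code_f 2 f) (p ^ 2) 4 (p ^ 2 - p - 1) 3,
      is_LRC (dual_code (code_f 2 f)) (p ^ 2) (p ^ 2 - 4) 4 (p ^ 2 - p - 2),
      k_optimal p (p ^ 2) 4 (p ^ 2 - p - 1) 3,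
      k_optimal p (p ^ 2) (p ^ 2 - 4) 4 (p ^ 2 - p - 2) &
      d_optimal (p ^ 2) (p ^ 2 - 4) 4 (p ^ 2 - p - 2)].
Proof.
move=> p_pr p_odd cardL _ [_ bent] sgn.
have p_gt2 := odd_prime_gt2 p_odd p_pr.
(* For e = 2 the square root of [pstar p] is squared away, and [eps * pstar p] is eps eta0(-1) p =
   -p. *)
have walsh b : \sum_x chi (f x - trace_Fp p 2 (b * x)) = - p%:R * chi (fstar b).
  rewrite /chi bent sqrtCK /pstar -eta0N1 // mulrA sgn mulN1r //.
set C := code_f 2 f.
have linC : is_lincode C by exact: code_f_lincode.
have cardC : #|C| = (p ^ 4)%N by exact: card_code_f walsh.
have dimC : code_dim C = 4%N by rewrite /code_dim cardC pfactorK.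
have minC : {in C, forall w, w != 0 -> (p ^ 2 - p - 1 <= wt w)%N}.
  by move=> w; exact: (code_f_mindist p_pr p_odd cardL walsh).
have minD : {in dual_code C, forall w, w != 0 -> (4 <= wt w)%N}.
  by move=> w; exact: (dual_mindist p_pr p_odd cardL walsh).
have coverC x : exists2 w, w \in C & w x != 0 /\ wt w = (p ^ 2 - p - 1)%N.
  have [w wC [wx zw]] := code_f_cover p_pr p_odd cardL walsh x.
  by exists w => //; split=> //; have := wt_zeros cardL w; rewrite zw; lia.
have coverD x : exists2 w, w \in dual_code C & w x != 0 /\ wt w = 4%N.
  exact: (dual_cover p_pr p_odd cardL walsh).
have nz0 (w : {ffun L -> 'F_p}) : w 0 != 0 -> w != 0.
  by apply: contraNneq => ->; rewrite ffunE.
have rE : ((p ^ 2 - p - 2).+1 = p ^ 2 - p - 1)%N by nia.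
have cL0 : (0 < #|L|)%N by rewrite cardL; nia.
split.
- split=> //; last exact: locality_dual_mindist.
  by apply/mindistP; split=> //; have [w wC [/nz0 w0 wd]] := coverC 0; exists w.
- split=> //; first exact: dual_lincode.
  + by have := code_dim_dual p_pr linC; rewrite dimC cardL => <-; rewrite addKn.
  + by apply/mindistP; split=> //; have [w wC [/nz0 w0 wd]] := coverD 0; exists w.
  + by apply: locality_dual_mindist; rewrite ?dualK ?rE //; apply: dual_lincode.
(* The value at t = 1 is 3 + 1 = 4, and t >= 2 already gives 3 t >= 6. *)
- split=> [|t t_gt0 _].
    by exists 1%N; rewrite mul1n kopt_eq1 //; split=> //; nia.
  have [->|t_gt1] := eqVneq t 1%N; first by rewrite mul1n kopt_eq1.
  by apply: leq_trans (leq_addr _ _); lia.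
- have koptE : kopt p (p ^ 2 - 1 * (p ^ 2 - p - 2).+1) 4 = (p - 2)%N.
    have -> : (p ^ 2 - 1 * (p ^ 2 - p - 2).+1 = p.+1)%N by nia.
    exact: kopt_p1_4 walsh.
  split=> [|t t_gt0 le_tn].
    by exists 1%N; rewrite koptE; split=> //; nia.
  (* Two blocks of length p^2 - p - 1 exceed p^2 when p >= 3. *)
  have -> : t = 1%N by nia.
  by rewrite koptE; nia.
- rewrite /d_optimal.
  (* With r = p^2 - p - 2, the dimension is r + (p - 2) and 0 < p - 2 <= r, so the ceiling is 2. *)
  have -> : ((p ^ 2 - 4 + (p ^ 2 - p - 2).-1) %/ (p ^ 2 - p - 2) = 2)%N.
    have -> : (p ^ 2 - 4 + (p ^ 2 - p - 2).-1 = 2 * (p ^ 2 - p - 2) + (p - 3))%N by nia.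
    by rewrite divnMDl; [rewrite divn_small //; nia|nia].
  nia.
Qed.
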